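(* For every positive integer $D$, there exist a 2-degenerate graph $G$ with $\Delta(G)\le D$ and a clique $S'$ in $G^2$ with $|S'|\ge g(D)-460$.
   Context: $g(D)$ denotes the maximum size of a clique in $G^2$ over all graphs $G$ with $\mathrm{mad}(G)<4$ and $\Delta(G)\le D$, where $\mathrm{mad}(G)=\max_{H\subseteq G}2|E(H)|/|V(H)|$. The square $G^2$ is obtained from $G$ by adding an edge between every pair of vertices at distance 2 in $G$. *)

(* Defs.v *)
From mathcomp Require Import all_boot.
Set Implicit Arguments. Unset Strict Implicit. Unset Printing Implicit Defensive.

Section Graphs.
Variables (T : finType) (e : rel T).

Definition simple_graph : Prop := symmetric e /\ irreflexive e.

Definition nbhd_in (A : {set T}) (x : T) : {set T} := [set y in A | e x y].

Definition max_degree_le (D : nat) : Prop := forall x : T, #|nbhd_in setT x| <= D.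

Definition edges_in (A : {set T}) : {set {set T}} :=
  [set s : {set T} | [exists x, exists y, e x y && (s == [set x; y])] && (s \subset A)].

(* mad(G) < 4 : every nonempty subgraph H satisfies 2|E(H)|/|V(H)| < 4.
   It suffices (and is equivalent) to quantify over induced subgraphs,
   which have the most edges on a given vertex set. *)
Definition mad_lt4 : Prop :=
  forall A : {set T}, A != set0 -> 2 * #|edges_in A| < 4 * #|A|.

Definition two_degenerate : Prop :=
  forall A : {set T}, A != set0 -> exists2 x, x \in A & #|nbhd_in A x| <= 2.

Definition sq_adj (x y : T) : bool :=
  (x != y) && (e x y || [exists z, e x z && e z y]).

Definition sq_clique (S : {set T}) : Prop :=
  forall x y, x \in S -> y \in S -> x != y -> sq_adj x y.

End Graphs.

(* Main.v *)
(* Let S be a clique in the square of G with |S| = k. Five hubs in a cycle give a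
   2-degenerate graph with a clique of about 5D/2, so let k >= 5D/2 + 452. Call a
   vertex big if it has at least k/15 neighbours in S, and a hub if it is in S or
   has at least 3 neighbours in S. A member of S reaches the k - 1 others through
   its at most D neighbours, so it needs two big neighbours, or else many small
   hubs. Yet mad(G) < 4 allows, up to an error linear in the number of big vertices
   (fewer than 60), only two hub edges per member of S, and a small hub refunds at
   most 2/3 of its edges. Hence all but a bounded number of members of S have
   exactly two hub neighbours, both big, and the edges at these members span a
   2-degenerate graph. *)
Require Import Defs.
From mathcomp Require Import all_boot.
From mathcomp Require Import zify.
From Stdlib Require Import Classical.
Set Implicit Arguments. Unset Strict Implicit. Unset Printing Implicit Defensive.

Section Degrees.
Variables (T : finType) (e : rel T).

Lemma card_nbhd_in (A : {set T}) x : #|nbhd_in e A x| = \sum_(y in A) e x y.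
Proof.
rewrite -sum1_card (eq_bigl (fun y => (y \in A) && e x y)); last by move=> y; rewrite inE.
by rewrite big_mkcondr; apply: eq_bigr => y _; case: (e x y).
Qed.

Lemma card_nbhd_inID (A B : {set T}) x :
  #|nbhd_in e A x| = #|nbhd_in e (A :&: B) x| + #|nbhd_in e (A :\: B) x|.
Proof. by rewrite !card_nbhd_in (big_setID B). Qed.

Lemma nbhd_inS (A B : {set T}) x :
  A \subset B -> nbhd_in e A x \subset nbhd_in e B x.
Proof.
move=> /subsetP sAB; apply/subsetP => y; rewrite !inE => /andP[/sAB -> ->] //.
Qed.

Lemma sum_nbhd_in_sym (A B : {set T}) : symmetric e ->
  \sum_(x in A) #|nbhd_in e B x| = \sum_(y in B) #|nbhd_in e A y|.
Proof.
move=> es; under eq_bigr do rewrite card_nbhd_in.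
rewrite exchange_big /=; apply: eq_bigr => y _; rewrite card_nbhd_in.
by apply: eq_bigr => x _; rewrite es.
Qed.

Lemma sum_degrees_le (A : {set T}) : simple_graph e ->
  \sum_(x in A) #|nbhd_in e A x| <= 2 * #|edges_in e A|.
Proof.
move=> [es ei].
pose P := [set p : T * T | [&& p.1 \in A, p.2 \in A & e p.1 p.2]].
have -> : \sum_(x in A) #|nbhd_in e A x| = \sum_(p in P) 1.
  under eq_bigr do rewrite -sum1_card.
  by rewrite pair_big_dep; apply: eq_bigl => -[x y]; rewrite !inE.
rewrite (partition_big (fun p => [set p.1; p.2]) (mem (edges_in e A))) /=; last first.
  move=> [x y]; rewrite !inE /= => /and3P[xA yA exy]; apply/andP; split.
    by apply/existsP; exists x; apply/existsP; exists y; rewrite exy eqxx.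
  by apply/subsetP => z; rewrite !inE => /orP[] /eqP->.
rewrite mulnC -sum_nat_const; apply: leq_sum => s.
rewrite inE => /andP[/existsP[a /existsP[b /andP[eab /eqP->]]] _].
rewrite sum1_card.
apply: (@leq_trans #|[set (a, b); (b, a)]|); last first.
  by rewrite cards2; case: eqP.
apply/subset_leq_card/subsetP => -[x y].
rewrite unfold_in !inE /= => /andP[/and3P[_ _ exy] /eqP E].
have : x \in [set a; b] by rewrite -E !inE eqxx.
have : y \in [set a; b] by rewrite -E !inE eqxx orbT.
rewrite !inE !xpair_eqE.
have nxy : x != y by apply: contraTneq exy => ->; rewrite ei.
by move=> /orP[] /eqP yE /orP[] /eqP xE; move: nxy; rewrite xE yE !eqxx ?orbT.
Qed.

Lemma sum_degrees_lt (A : {set T}) : simple_graph e -> mad_lt4 e -> A != set0 ->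
  \sum_(x in A) #|nbhd_in e A x| < 4 * #|A|.
Proof. by move=> es em /em; apply: leq_ltn_trans; apply: sum_degrees_le. Qed.

Lemma sq_clique_cover (S : {set T}) x : symmetric e -> sq_clique e S -> x \in S ->
  #|S| <= 1 + \sum_(v in nbhd_in e setT x) ((#|nbhd_in e S v| - 1) + (v \in S)).
Proof.
move=> es cS xS; rewrite (cardsD1 x) xS leq_add2l.
pose F v := (nbhd_in e S v :\ x) :|: (if v \in S then [set v] else set0).
apply: (@leq_trans #|\bigcup_(v in nbhd_in e setT x) F v|).
  apply/subset_leq_card/subsetP => y; rewrite !inE => /andP[nyx yS].
  have /andP[_ /orP[exy|/existsP[z /andP[exz ezy]]]] : sq_adj e x y.
    by apply: cS => //; rewrite eq_sym.
    by apply/bigcupP; exists y; rewrite ?inE // yS !inE eqxx orbT.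
  by apply/bigcupP; exists z; rewrite ?inE // nyx yS ezy.
have leU (I : finType) (P : pred I) (G : I -> {set T}) :
    #|\bigcup_(i in P) G i| <= \sum_(i in P) #|G i|.
  elim/big_rec2: _ => [|i n A _ le]; first by rewrite cards0.
  by rewrite (leq_trans (leq_card_setU _ _)) // leq_add2l.
apply: leq_trans (leU _ _ _) _; apply: leq_sum => v; rewrite !inE /= => exv.
apply: leq_trans (leq_card_setU _ _) _; apply: leq_add.
  by rewrite [X in _ <= X - 1](cardsD1 x) inE xS es exv addKn.
by case: ifP; rewrite ?cards1 ?cards0.
Qed.

Lemma sq_clique_bound (S : {set T}) D : symmetric e -> max_degree_le e D ->
  sq_clique e S -> #|S| <= 1 + D * D.
Proof.
move=> es eD cS; case: (set_0Vmem S) => [->|[x xS]]; first by rewrite cards0.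
apply: leq_trans (sq_clique_cover es cS xS) _; rewrite leq_add2l.
apply: (@leq_trans (\sum_(v in nbhd_in e setT x) D)); last first.
  by rewrite sum_nat_const leq_mul2r eD orbT.
apply: leq_sum => v; rewrite !inE /= => exv.
have v0 : 0 < #|nbhd_in e S v| by apply/card_gt0P; exists x; rewrite inE xS es.
have vD : #|nbhd_in e S v| <= D.
  by apply: leq_trans (eD v); apply/subset_leq_card/nbhd_inS/subsetT.
by case: (v \in S); lia.
Qed.

Lemma two_degenerate_bip (S B : {set T}) : symmetric e ->
  (forall x y, e x y -> (x \in S) (+) (y \in S)) ->
  (forall v, v \notin S -> v \notin B -> #|nbhd_in e S v| <= 2) ->
  (forall x, x \in S -> #|nbhd_in e B x| <= 2) ->
  two_degenerate e.
Proof.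
move=> es eS dN dS A A0.
have [sA|/subsetPn[v vA]] := boolP (A \subset S :|: B); last first.
  rewrite inE negb_or => /andP[vS vB]; exists v => //.
  apply: leq_trans (dN v vS vB); apply/subset_leq_card/subsetP => y.
  by rewrite !inE => /andP[_ evy]; rewrite evy andbT; move: (eS _ _ evy); rewrite (negbTE vS).
have [AS|[x]] := set_0Vmem (A :&: S).
  have /set0Pn[x xA] := A0; exists x => //.
  rewrite (_ : nbhd_in e A x = set0) ?cards0 //; apply/setP => y; rewrite !inE.
  apply/negP => /andP[yA /eS].
  have nS z : z \in A -> z \in S = false.
    by move=> zA; move/setP/(_ z): AS; rewrite !inE zA.
  by rewrite !nS.
rewrite inE => /andP[xA xS]; exists x => //.
apply: leq_trans (dS x xS); apply/subset_leq_card/subsetP => y.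
rewrite !inE => /andP[yA exy]; rewrite exy andbT.
by move/subsetP/(_ y yA): sA; move: (eS _ _ exy); rewrite inE xS; case: (y \in S).
Qed.

End Degrees.

Section LargeClique.
Variables (T : finType) (e : rel T) (S : {set T}) (D : nat).
Hypotheses (eG : simple_graph e) (e_mad : mad_lt4 e).
Hypotheses (eD : max_degree_le e D) (S_clique : sq_clique e S).
Hypothesis S_large : 5 * D + 905 < 2 * #|S|.

Let es : symmetric e := proj1 eG.
Local Notation d v := #|nbhd_in e S v|.
Let hubs := S :|: [set v | 2 < d v].
Let big := [set v | #|S| <= 15 * d v].
Let outer := [set v | 2 < d v] :\: S.

Let hubsE : hubs = S :|: outer.
Proof. by apply/setP => v; rewrite !inE; case: (v \in S). Qed.

Let hubs_budget :
  \sum_(x in S) d x + 2 * \sum_(v in outer) d v < 4 * #|S| + 4 * #|outer|.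
Proof.
have h0 : hubs != set0.
  have /card_gt0P[x xS] : 0 < #|S| by lia.
  by apply/set0Pn; exists x; rewrite inE xS.
have hS : hubs :&: S = S by apply/setIidPr/subsetUl.
have ho : hubs :\: S = outer by rewrite hubsE setDUl setDv set0U setDDl setUid.
have := sum_degrees_lt eG e_mad h0.
have -> : #|hubs| = #|S| + #|outer| by rewrite -(cardsID S) hS ho.
rewrite mulnDr (big_setID S) /= hS ho.
under eq_bigr do rewrite (card_nbhd_inID e hubs S) hS ho.
under [X in _ + X]eq_bigr do rewrite (card_nbhd_inID e hubs S) hS ho.
rewrite !big_split /= (sum_nbhd_in_sym S outer es); lia.
Qed.

Let sum_outer_small : 3 * #|outer :\: big| <= \sum_(v in outer :\: big) d v.
Proof. by rewrite mulnC -sum_nat_const leq_sum // => v; rewrite !inE; lia. Qed.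

Let card_big : #|big| < 60.
Proof.
have := hubs_budget; rewrite (big_setID big) [X in _ + 2 * X](big_setID big) /=.
rewrite -(cardsID big outer).
have : #|big| * #|S| <= 15 * \sum_(v in big) d v.
  rewrite -sum_nat_const big_distrr leq_sum // => v; rewrite inE //.
have -> : \sum_(v in big) d v = \sum_(v in S :&: big) d v + \sum_(v in outer :&: big) d v.
  rewrite (big_setID S) /= setIC; congr (_ + _); apply: eq_bigl => v.
  by rewrite !inE; lia.
have : 4 * #|outer :&: big| <= \sum_(v in outer :&: big) d v.
  by rewrite mulnC -sum_nat_const leq_sum // => v; rewrite !inE; lia.
move: sum_outer_small S_large; nia.
Qed.

Let S1 := S :\: big.
Let weight x := 3 * #|nbhd_in e big x| + #|nbhd_in e (hubs :\: big) x|.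

(* A small hub outside [S] with [d >= 3] neighbours adds [d - 2 >= d / 3] to the
   budget inequality, hence the relative cost 3 : 1 of big and small hubs. *)
Let sum_weight : \sum_(x in S1) weight x <= 6 * #|S1| + 6 * #|big|.
Proof.
have dS1 v : #|nbhd_in e S1 v| <= d v by apply/subset_leq_card/nbhd_inS/subsetDl.
rewrite /weight big_split -big_distrr /= !(sum_nbhd_in_sym S1 _ es).
have cS := cardsID big S; have cO := cardsID big outer; have cB := cardsID S big.
have bS : big :&: S = S :&: big by rewrite setIC.
have bO : big :\: S = outer :&: big.
  by apply/setP => v; rewrite !inE; lia.
have hD : hubs :\: big = S1 :|: (outer :\: big) by rewrite hubsE setDUl.
have dis : [disjoint S1 & outer :\: big].
  by apply/pred0P => v; rewrite !inE; case: (v \in S); rewrite ?andbF.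
rewrite [X in 3 * X](big_setID S) /= bS bO hD.
rewrite [X in _ + X](big_setID S1) /= setUK setDUl setDv set0U.
have -> : (outer :\: big) :\: S1 = outer :\: big.
  by apply/setDidPl; rewrite disjoint_sym.
have := hubs_budget; rewrite (big_setID big) [X in _ + 2 * X](big_setID big) /= -/S1.
under [X in _ + X + _]eq_bigr do rewrite (card_nbhd_inID e S big) -/S1.
rewrite big_split /= (sum_nbhd_in_sym S1 (S :&: big) es).
have := sum_outer_small.
have leS (A : {set T}) : \sum_(v in A) #|nbhd_in e S1 v| <= \sum_(v in A) d v.
  by apply: leq_sum.
have := leS (S :&: big); have := leS (outer :&: big); have := leS (outer :\: big).
rewrite -/S1 bS bO in cS cB; lia.
Qed.

Let weight_cover x : x \in S ->
  15 * #|S| <= 15 + 15 * D + 15 * (#|nbhd_in e big x| * D)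
               + #|nbhd_in e (hubs :\: big) x| * #|S|.
Proof.
move=> xS; have := sq_clique_cover es S_clique xS.
set c := (X in _ <= 1 + X) => le.
suff : 15 * c <= 15 * D + 15 * (#|nbhd_in e big x| * D)
               + #|nbhd_in e (hubs :\: big) x| * #|S| by lia.
have sumE (A : {set T}) k : #|nbhd_in e A x| * k =
    \sum_(v in nbhd_in e setT x) (v \in A) * k.
  rewrite -big_distrl /=; congr (_ * _); rewrite -sum1_card big_mkcond [RHS]big_mkcond.
  by apply: eq_bigr => v _; rewrite !inE; case: (v \in A); case: (e x v).
apply: (@leq_trans (15 * (#|nbhd_in e setT x| * 1) + 15 * (#|nbhd_in e big x| * D)
               + #|nbhd_in e (hubs :\: big) x| * #|S|)); last first.
  by rewrite !leq_add2r leq_mul2l muln1 eD orbT.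
rewrite !sumE !big_distrr -!big_split /=; apply: leq_sum => v; rewrite !inE /= => exv.
have v0 : 0 < d v by apply/card_gt0P; exists x; rewrite inE xS es.
have vD : d v <= D.
  by apply: leq_trans (eD v); apply/subset_leq_card/nbhd_inS/subsetT.
case: (v \in S); case: (leqP #|S| (15 * d v)) => ? /=; case: (ltnP 2 (d v)) => ? /=; lia.
Qed.

Let weight_ge6 x : x \in S -> 6 <= weight x.
Proof.
move=> /weight_cover; rewrite /weight.
move: #|nbhd_in e big x| #|nbhd_in e (hubs :\: big) x| => b n.
case: b => [|[|b]]; last by lia.
  by move=> H; case: (leqP 6 n) => [|n6]; [lia | have := leq_mul n6 (leqnn #|S|); lia].
move=> H; case: (leqP 4 n) => [|n4]; first by lia.
have : n * #|S| <= 3 * #|S| by rewrite leq_mul2r; lia.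
lia.
Qed.

Let weight_eq6 x : x \in S -> weight x = 6 ->
  #|nbhd_in e big x| = 2 /\ nbhd_in e (hubs :\: big) x = set0.
Proof.
move=> /weight_cover; rewrite /weight => H w; suff [-> /eqP] :
  #|nbhd_in e big x| = 2 /\ #|nbhd_in e (hubs :\: big) x| = 0 by rewrite cards_eq0 => /eqP.
move: H w; move: #|nbhd_in e big x| #|nbhd_in e (hubs :\: big) x| => b n.
case: b => [|[|b]] H w; last by lia.
  by have E : n = 6 by [lia]; move: H; rewrite E; lia.
by have E : n = 3 by [lia]; move: H; rewrite E; lia.
Qed.

Let good := [set x in S1 | weight x == 6].

Let card_good : #|S| <= #|good| + 460.
Proof.
have c1 : #|S1| + #|big| >= #|S|.
  by rewrite -(cardsID big S) addnC leq_add2l subset_leq_card ?subsetIr.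
have c2 : 6 * #|S1| + #|S1 :\: good| <= \sum_(x in S1) weight x.
  rewrite mulnC -sum_nat_const -sum1_card.
  rewrite (big_setID good) [X in _ <= X](big_setID good) /= -addnA leq_add //.
    by apply: leq_sum => x; rewrite !inE => /and3P[/andP[_ /weight_ge6]].
  rewrite -big_split; apply: leq_sum => x; rewrite !inE => /andP[].
  move=> + /andP[xb xS]; rewrite xb xS /=.
  by have := weight_ge6 xS; lia.
have c3 := cardsID good S1.
have c4 : S1 :&: good = good by apply/setIidPr/subsetP => x; rewrite inE => /andP[].
move: sum_weight card_big; rewrite c4 in c3; lia.
Qed.

Lemma large_clique_two_degenerate : exists (e' : rel T) (S' : {set T}),
  [/\ simple_graph e', two_degenerate e', max_degree_le e' D, sq_clique e' S' &
      #|S| <= #|S'| + 460].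
Proof.
pose e' x y := e x y && ((x \in good) || (y \in good)).
have goodP x : x \in good -> [/\ x \in S, #|nbhd_in e big x| = 2 &
    forall y, e x y -> y \in hubs -> y \in big].
  rewrite !inE => /andP[/andP[_ xS] /eqP w6].
  have [b2 n0] := weight_eq6 xS w6; split=> // y exy yh; apply: contraT => yb.
  by have := in_set0 y; rewrite -n0 inE in_setD yb yh exy.
have goodS1 x : x \in good -> x \notin big by rewrite inE => /andP[/setDP[]].
have good_indep x y : x \in good -> y \in good -> ~~ e x y.
  move=> /goodP[_ _ xb] yg; apply: contra (goodS1 _ yg) => exy; apply: xb => //.
  by have [yS _ _] := goodP _ yg; rewrite inE yS.
have sub A x : nbhd_in e' A x \subset nbhd_in e A x.
  by apply/subsetP => y; rewrite !inE => /andP[-> /andP[->]].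
have e's : symmetric e' by move=> x y; rewrite /e' es orbC.
exists e', good; split => //.
- by split=> // x; rewrite /e' (proj2 eG).
- apply: (@two_degenerate_bip _ _ good big) => //.
  + move=> x y /andP[exy].
    have := good_indep x y; case: (x \in good); case: (y \in good) => //= H _.
    by move: (H isT isT); rewrite exy.
  + move=> v vg vb; have [->|[x]] := set_0Vmem (nbhd_in e' good v); first by rewrite cards0.
    rewrite inE => /andP[xg /andP[evx _]].
    have [_ _ /(_ v)] := goodP _ xg; rewrite es evx (negbTE vb) => /(_ isT) vh.
    apply: (@leq_trans (d v)).
      apply: leq_trans (subset_leq_card (sub _ _)) _; apply/subset_leq_card/nbhd_inS.
      by apply/subsetP => y /goodP[].
    by rewrite leqNgt; apply/negP => d3; have := vh; rewrite !inE d3 orbT => /(_ isT).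
  + move=> x /goodP[_ <- _]; exact/subset_leq_card/sub.
- by move=> x; apply: leq_trans (eD x); apply/subset_leq_card/sub.
- move=> x y xg yg nxy; have [xS _ _] := goodP _ xg; have [yS _ _] := goodP _ yg.
  have /andP[_ /orP[exy|/existsP[z /andP[exz ezy]]]] := S_clique xS yS nxy.
    by move: (good_indep _ _ xg yg); rewrite exy.
  rewrite /sq_adj nxy; apply/orP; right; apply/existsP; exists z.
  by rewrite /e' exz ezy xg yg orbT.
Qed.

End LargeClique.

(* Five hubs arranged in a cycle; the vertices of the clique form five groups of
   size [m], group [i] being joined to the hubs [i] and [i+1]. Members of groups
   at cyclic distance 2 get a private common neighbour. *)
Section BlownUpCycle.
Variable m : nat.

Local Notation clique_vertex := ('I_5 * 'I_m)%type.
Local Notation hub_or_middle := ('I_5 + 'I_5 * 'I_m * 'I_m)%type.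
Local Notation cycle_vertex := (clique_vertex + hub_or_middle)%type.

Definition cycle_incidence (x : clique_vertex) (v : hub_or_middle) : bool :=
  match v with
  | inl h => (h == x.1) || (h == ordS x.1)
  | inr (i, a, b) => ((i, a) == x) || ((ordS (ordS i), b) == x)
  end.

Definition cycle_adj (p q : cycle_vertex) : bool :=
  match p, q with
  | inl x, inr v | inr v, inl x => cycle_incidence x v
  | _, _ => false
  end.

Definition cycle_clique : {set cycle_vertex} := [set inl x | x : clique_vertex].
Definition cycle_hubs : {set cycle_vertex} := [set inr (inl h) | h : 'I_5].

Lemma cycle_adj_simple : simple_graph cycle_adj.
Proof. by split; [move=> [x|v] [y|w] | move=> [x|v]]. Qed.

Lemma mem_cycle_clique p : (p \in cycle_clique) = if p is inl _ then true else false.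
Proof.
case: p => [x|v]; first by rewrite imset_f.
by apply/negbTE/imsetP => -[].
Qed.

Lemma card_cycle_clique : #|cycle_clique| = 5 * m.
Proof. by rewrite card_imset ?cardsT ?card_prod ?card_ord // => x y []. Qed.

Lemma cycle_hub_nbhd x : nbhd_in cycle_adj cycle_hubs (inl x) \subset
  [set inr (inl x.1); inr (inl (ordS x.1))].
Proof.
apply/subsetP => p; rewrite inE => /andP[/imsetP[h _ ->]] /=.
by rewrite !inE => /orP[] /eqP->; rewrite eqxx ?orbT.
Qed.

Lemma cycle_middle_nbhd i a b (A : {set cycle_vertex}) :
  nbhd_in cycle_adj A (inr (inr (i, a, b))) \subset
  [set inl (i, a); inl (ordS (ordS i), b)].
Proof.
apply/subsetP => -[x|v]; rewrite !inE ?andbF //= => /andP[_].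
by move=> /orP[] /eqP->; rewrite eqxx ?orbT.
Qed.

Lemma cycle_adj_two_degenerate : two_degenerate cycle_adj.
Proof.
apply: (@two_degenerate_bip _ _ cycle_clique cycle_hubs).
- exact: proj1 cycle_adj_simple.
- by move=> [x|v] [y|w] //=; rewrite !mem_cycle_clique.
- move=> [x|[h|[[i a] b]]]; rewrite ?mem_cycle_clique ?imset_f // => _ _.
  apply: leq_trans (subset_leq_card (cycle_middle_nbhd _ _ _ _)) _.
  by rewrite cards2; case: eqP.
- move=> [x|v]; rewrite mem_cycle_clique // => _.
  apply: leq_trans (subset_leq_card (cycle_hub_nbhd x)) _.
  by rewrite cards2; case: eqP.
Qed.

Lemma cycle_adj_max_degree D : 2 * m + 2 <= D -> max_degree_le cycle_adj D.
Proof.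
move=> mD [[j c]|[h|[[i a] b]]].
- pose M1 : {set cycle_vertex} := [set inr (inr (j, c, b)) | b : 'I_m].
  pose M2 : {set cycle_vertex} :=
    [set inr (inr (ord_pred (ord_pred j), a, c)) | a : 'I_m].
  apply: (@leq_trans #|[set inr (inl j); inr (inl (ordS j))] :|: (M1 :|: M2)|).
    apply/subset_leq_card/subsetP => -[x|[h|[[i a] b]]]; rewrite !inE //=.
      by move=> /orP[] /eqP->; rewrite eqxx ?orbT.
    move=> /orP[] /eqP [].
      by rewrite /M1 => -> ->; apply/orP; left; apply: imset_f.
    by rewrite /M2 => <- <-; apply/orP; right; apply/imsetP; exists a; rewrite // !ordSK.
  apply: leq_trans (leq_card_setU _ _) _; apply: (leq_trans _ mD); rewrite addnC.
  apply: leq_add; last by rewrite cards2; case: eqP.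
  apply: leq_trans (leq_card_setU _ _) _; rewrite mul2n -addnn.
  by apply: leq_add; apply: leq_trans (leq_imset_card _ _) _; rewrite card_ord.
- pose M i : {set cycle_vertex} := [set inl (i, a) | a : 'I_m].
  apply: (@leq_trans #|M h :|: M (ord_pred h)|).
    apply/subset_leq_card/subsetP => -[[i a]|v]; rewrite !inE //=.
    move=> /orP[] /eqP->; apply/orP; [left|right]; first exact: imset_f.
    by rewrite ordSK; apply: imset_f.
  have cM i : #|M i| <= m.
    by apply: leq_trans (leq_imset_card _ _) _; rewrite card_ord.
  apply: leq_trans (leq_card_setU _ _) _; have := cM h; have := cM (ord_pred h); lia.
- apply: leq_trans (subset_leq_card (cycle_middle_nbhd _ _ _ _)) _.
  by apply: leq_trans mD; rewrite cards2 addn2; case: eqP.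
Qed.

Lemma ord5_cyclic_distance (i j : 'I_5) :
  [|| j == i, j == ordS i, i == ordS j, j == ordS (ordS i) | i == ordS (ordS j)].
Proof. by case: i => i i5; case: j => j j5; rewrite -!val_eqE /=; lia. Qed.

Lemma cycle_sq_clique : sq_clique cycle_adj cycle_clique.
Proof.
move=> [[i a]|v] [[j b]|w]; rewrite ?mem_cycle_clique // => _ _ nxy.
rewrite /sq_adj nxy; apply/orP; right; apply/existsP.
case/or4P: (ord5_cyclic_distance i j) => [/eqP->|/eqP->|/eqP->|/orP[]/eqP->].
- by exists (inr (inl i)); rewrite /= !eqxx.
- by exists (inr (inl (ordS i))); rewrite /= !eqxx orbT.
- by exists (inr (inl (ordS j))); rewrite /= !eqxx orbT.
- by exists (inr (inr (i, a, b))); rewrite /= !eqxx orbT.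
- by exists (inr (inr (j, b, a))); rewrite /= !eqxx orbT.
Qed.

End BlownUpCycle.

Lemma two_degenerate_half5 D : exists (T : finType) (e : rel T) (S : {set T}),
  [/\ simple_graph e, two_degenerate e, max_degree_le e D, sq_clique e S &
      5 * D <= 2 * #|S| + 15].
Proof.
case: (leqP D 3) => D3.
  exists unit, (fun _ _ => false), set0; split=> //.
  - move=> A /set0Pn[x xA]; exists x => //.
    by apply: leq_trans (max_card _) _; rewrite card_unit.
  - move=> x; rewrite (_ : nbhd_in _ _ _ = set0) ?cards0 //.
    by apply/setP => y; rewrite !inE.
  - by rewrite cards0; lia.
pose m := (D - 2) %/ 2.
exists ('I_5 * 'I_m + ('I_5 + 'I_5 * 'I_m * 'I_m))%type.
exists (@cycle_adj m), (cycle_clique m); split.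
- exact: cycle_adj_simple.
- exact: cycle_adj_two_degenerate.
- by apply: cycle_adj_max_degree; rewrite /m; lia.
- exact: cycle_sq_clique.
- by rewrite card_cycle_clique /m; lia.
Qed.

Lemma two_degenerate_clique (T0 : finType) (e0 : rel T0) (S : {set T0}) D :
  simple_graph e0 -> mad_lt4 e0 -> max_degree_le e0 D -> sq_clique e0 S ->
  exists (T : finType) (e : rel T) (S' : {set T}),
  [/\ simple_graph e, two_degenerate e, max_degree_le e D, sq_clique e S' &
      #|S| <= #|S'| + 460].
Proof.
move=> sG mG dG cS; case: (leqP (2 * #|S|) (5 * D + 905)) => [small|large].
  have [T [e [S' [? ? ? ? H]]]] := two_degenerate_half5 D.
  by exists T, e, S'; split=> //; lia.
by exists T0; exact: (large_clique_two_degenerate sG mG dG cS large).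
Qed.

(* g(D) is the maximum of |S| over graphs H with mad(H) < 4, Delta(H) <= D and
   cliques S of H^2; "|S'| >= g(D) - 460" is stated as: |S| <= |S'| + 460 for
   every such H and S (see NOTES.md). *)
Theorem theorem4 (D : nat) (HD : 0 < D) :
  exists (T : finType) (e : rel T) (S' : {set T}),
    [/\ simple_graph e, two_degenerate e, max_degree_le e D, sq_clique e S' &
      forall (T0 : finType) (e0 : rel T0) (S : {set T0}),
        simple_graph e0 -> mad_lt4 e0 -> max_degree_le e0 D -> sq_clique e0 S ->
        #|S| <= #|S'| + 460].
Proof.
pose all_le n := forall (T0 : finType) (e0 : rel T0) (S : {set T0}),
  simple_graph e0 -> mad_lt4 e0 -> max_degree_le e0 D -> sq_clique e0 S -> #|S| <= n.
have : all_le (1 + D * D) by move=> T0 e0 S [es _] _; apply: sq_clique_bound.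
elim: (1 + D * D) => [|n IHn] le_n.
  have [T [e [S' [? ? ? ? _]]]] := two_degenerate_half5 D.
  exists T, e, S'; split=> // T0 e0 S sG mG dG cS.
  by have := le_n _ _ _ sG mG dG cS; lia.
have [/IHn //|] := classic (all_le n).
move=> /not_all_ex_not[T0] /not_all_ex_not[e0] /not_all_ex_not[S] nle.
have [sG nle1] := imply_to_and _ _ nle; have [mG nle2] := imply_to_and _ _ nle1.
have [dG nle3] := imply_to_and _ _ nle2; have [cS ltS] := imply_to_and _ _ nle3.
have [T [e [S' [? ? ? ? leS]]]] := two_degenerate_clique sG mG dG cS.
exists T, e, S'; split=> // T1 e1 S1 sG1 mG1 dG1 cS1.
have := le_n _ _ _ sG1 mG1 dG1 cS1; lia.
Qed.
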